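(* Let $p$ be an odd prime and let $P$ be a finite non-abelian metacyclic $p$-group. Let $K\trianglelefteq P$ be a metacyclic structure of $P$. Then: (a) $K$ is non-splittable if and only if $|K|<\exp(P)$ and $|P:K|<\exp(P)$; (b) $K$ is splittable but not automatically split if and only if $|K|=\exp(P)>|P:K|$; (c) $K$ is automatically split if and only if $|P:K|=\exp(P)$.
   Context: $\exp(G)$ denotes the exponent of a finite group $G$. A metacyclic structure of a finite group $G$ is a cyclic normal subgroup $K\trianglelefteq G$ such that $G/K$ is also cyclic; $G$ is metacyclic if it has a metacyclic structure. A metacyclic factorization $G=SK$ is a metacyclic structure $K\trianglelefteq G$ together with a cyclic subgroup $S$ of $G$ such that $K$ and $S$ together generate $G$. It is called split if $S\cap K$ is trivial (i.e. $G=K\rtimes S$), otherwise non-split. A metacyclic factorization $G=SK$, and correspondingly the underlying metacyclic structure $K\trianglelefteq G$, is called - splittable if there is a cyclic subgroup $R$ of $G$ (possibly $R=S$) such that $G=RK$ is a split metacyclic factorization; - non-splittable if every metacyclic factorization $G=RK$ with the given $K$ is non-split; - automatically split if every metacyclic factorization $G=RK$ with the given $K$ is split. *)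

(* Defs.v *)
From mathcomp Require Import all_boot all_fingroup all_solvable.

Set Implicit Arguments.
Unset Strict Implicit.
Unset Printing Implicit Defensive.

Local Open Scope group_scope.

Definition metacyclic_structure (gT : finGroupType) (G K : {group gT}) : bool :=
  [&& cyclic K, K <| G & cyclic (G / K)].

(* G = S * K: since K is normal, the join S <*> K is the product set. *)
Definition metacyclic_factorization (gT : finGroupType)
    (G S K : {group gT}) : bool :=
  [&& metacyclic_structure G K, cyclic S, S \subset G & S <*> K == G].

Definition split_factorization (gT : finGroupType)
    (G S K : {group gT}) : bool :=
  metacyclic_factorization G S K && (S :&: K == 1).

(* The next three are properties of a metacyclic structure K of G: the last two
   hold vacuously for any other K. *)
Definition splittable (gT : finGroupType) (G K : {group gT}) : Prop :=
  exists R : {group gT}, split_factorization G R K.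

Definition non_splittable (gT : finGroupType) (G K : {group gT}) : Prop :=
  forall R : {group gT},
    metacyclic_factorization G R K -> ~~ split_factorization G R K.

Definition automatically_split (gT : finGroupType) (G K : {group gT}) : Prop :=
  forall R : {group gT},
    metacyclic_factorization G R K -> split_factorization G R K.

(* Main.v *)
Require Import Defs.
From mathcomp Require Import all_boot all_fingroup all_solvable.
From mathcomp Require Import ring.

(** Write q = |P : K|.  The subgroups S with P = S K are the cyclic groups
<[x]> with x generating P modulo K; since <[x]> / (<[x]> :&: K) is isomorphic
to P / K, the order of x is q |<[x]> :&: K|, and the factorization is split
exactly when x ^+ q = 1 ([split_factorizationE]).  Replacing x by x * y with y
in K gives another factorization, so everything depends on how powers of x * y
vary with y.

For odd p this is as simple as possible ([expMg_p_power]): raising x * y to a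
power of p multiplies x ^+ (p ^ n) by y ^+ (p ^ n * w), where the exponent w is
prime to p and does not depend on y.  Indeed x acts on the cyclic p-group K by
y |-> y ^+ u with u = 1 mod p, so (x * y) ^+ p is x ^+ p times the power of y
with exponent 1 + u + ... + u ^ (p - 1); as 'C(p, 2) is divisible by p, this
sum is p modulo p ^ 2.  Three consequences follow.

- The exponent of P = S K is the larger of |S| and |K|
  ([exponent_factorization]), and |S| >= q.  So a split factorization forces
  exp P = max(q, |K|).
- If q = exp P then |S| <= q, so that every factorization is split.
  Conversely, if x and x * k are both of order q with K = <[k]>, then
  k ^+ (q * w) = 1, so |K| <= q and exp P = q ([automatically_splitE]).
- If |K| = exp P then x ^+ |K| = 1, and this makes x ^+ q a q-th power in K;
  a suitable y in K cancels it, so that (x * y) ^+ q = 1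
  ([splittable_card_exponent]).

Hence K is splittable exactly when q or |K| is the exponent of P, and
automatically split exactly when q is; the three claims are the possible
combinations, since neither q nor |K| exceeds exp P. *)

Local Open Scope group_scope.

(** * Powers of p in a cyclic extension of a cyclic p-group *)

(** Modulo p ^ 2, writing u = 1 + p v, the power u ^ i is 1 + i p v, so the sum
is p + 'C(p, 2) p v.  Oddness of p is what makes p divide 'C(p, 2); for p = 2
and u = 3 the sum is 4, and the conclusion fails. *)
Lemma sum_geometric_prime {p u : nat} :
  prime p -> odd p -> u = 1 %[mod p] ->
  exists2 w, coprime p w & (\sum_(i < p) u ^ i = p * w)%N.
Proof.
move=> p_pr p_odd u1.
have [v ->] : exists v, (u = 1 + p * v)%N.
  exists (u %/ p)%N.
  by rewrite {1}(divn_eq u p) u1 modn_small ?prime_gt1 // addnC mulnC.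
have expE m : exists c, ((1 + p * v) ^ m = 1 + m * (p * v) + p ^ 2 * c)%N.
  elim: m => [|m [c IHm]]; first by exists 0%N; rewrite muln0.
  exists (m * v ^ 2 + c * (1 + p * v))%N.
  by rewrite expnS IHm; ring.
have sumE m : exists c,
    (\sum_(i < m) (1 + p * v) ^ i = m + 'C(m, 2) * (p * v) + p ^ 2 * c)%N.
  elim: m => [|m [c IHm]]; first by exists 0%N; rewrite big_ord0 muln0.
  have [d dE] := expE m; exists (c + d)%N.
  by rewrite big_ord_recr /= IHm dE binS bin1; ring.
have [c ->] := sumE p.
have p_gt2 : (2 < p)%N by rewrite odd_prime_gt2.
have /dvdnP[d ->] : (p %| 'C(p, 2))%N by rewrite prime_dvd_bin.
exists (1 + p * (d * v + c))%N; last by ring.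
by rewrite /coprime addnC mulnC gcdnMDl gcdn1.
Qed.

Lemma expMg_conj_power {gT : finGroupType} (x y : gT) (u m : nat) :
  y ^ x = y ^+ u -> (x * y) ^+ m = x ^+ m * y ^+ (\sum_(i < m) u ^ i).
Proof.
move=> yx; elim: m => [|m IHm]; first by rewrite big_ord0 !expg0 mulg1.
have -> : (\sum_(i < m.+1) u ^ i = u * \sum_(i < m) u ^ i + 1)%N.
  rewrite big_ord_recl addnC big_distrr.
  by congr (_ + _)%N; apply: eq_bigr => i _; rewrite expnS.
rewrite expgSr IHm expgD expg1 expgM -yx -conjXg expgSr -!mulgA.
by rewrite mulKVg.
Qed.

(** The automorphism induced by x has p-power order, so u to some power of p is
1 modulo p; by Fermat's little theorem u itself is. *)
Lemma p_elt_cyclic_action {gT : finGroupType} {p : nat} {K : {group gT}}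
    {x : gT} :
  prime p -> p.-group K -> cyclic K -> p.-elt x -> x \in 'N(K) ->
  exists2 u, u = 1 %[mod p] & {in K, forall y, y ^ x = y ^+ u}.
Proof.
move=> p_pr pK /cyclicP[k defK] px nKx.
have Kk : k \in K by rewrite defK cycle_id.
(* For trivial K the action puts no constraint on u, which must be chosen. *)
have [k1 | ntk] := eqVneq k 1.
  exists 1%N => // y; rewrite defK k1 cycle1 => /set1P->.
  by rewrite conj1g expg1n.
have /cycleP[u kx] : k ^ x \in <[k]> by rewrite -defK memJ_norm.
exists u; last first.
  by move=> y; rewrite defK => /cycleP[i ->]; rewrite conjXg kx -!expgM mulnC.
have kxm m : k ^ (x ^+ m) = k ^+ (u ^ m).
  elim: m => [|m IHm]; first by rewrite conjg1 expg1.
  by rewrite expgSr conjgM IHm conjXg kx -expgM expnS.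
have [n oxE] := p_natP px.
have dvd_p : (p %| #[k])%N.
  have pk : p.-elt k := mem_p_elt pK Kk.
  by have [|_] := pgroup_pdiv pk; first by rewrite cycle_eq1.
have /eqP : k ^+ (u ^ #[x]) == k ^+ 1 by rewrite -kxm expg_order conjg1 expg1.
move/eqP; rewrite eq_expg_mod_order => /eqP mod_k.
have {mod_k} : u ^ #[x] = 1 %[mod p].
  by rewrite -(modn_dvdm _ dvd_p) mod_k modn_dvdm.
rewrite oxE => <-; elim: n {oxE} => [|n IHn] //.
by rewrite expnS expnM -[RHS]modnXm fermat_little // modnXm.
Qed.

(** By induction on n: the p-th power of x ^+ (p ^ n) * y', with y' in K, is
computed by [sum_geometric_prime] for the action of x ^+ (p ^ n) on K.  That w
is prime to p means that y ^+ w is as general an element of K as y; that it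
does not depend on y allows y to be chosen afterwards. *)
Lemma expMg_p_power {gT : finGroupType} {p : nat} {K : {group gT}} {x : gT}
    (n : nat) :
  prime p -> odd p -> p.-group K -> cyclic K -> p.-elt x -> x \in 'N(K) ->
  exists2 w, coprime p w
    & {in K, forall y, (x * y) ^+ (p ^ n) = x ^+ (p ^ n) * y ^+ (p ^ n * w)}.
Proof.
move=> p_pr p_odd pK cK px nKx; elim: n => [|n [w co_w IHn]].
  by exists 1%N => [|y _]; rewrite ?coprimen1.
have px' : p.-elt (x ^+ (p ^ n)) by apply: p_eltX.
have nKx' : x ^+ (p ^ n) \in 'N(K) by rewrite groupX.
have [u u1 actK] := p_elt_cyclic_action p_pr pK cK px' nKx'.
have [v co_v sumE] := sum_geometric_prime p_pr p_odd u1.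
exists (w * v)%N => [|y Ky]; first by rewrite coprimeMr co_w.
rewrite expnSr expgM IHn // (expMg_conj_power _ _ u) ?actK ?groupX // sumE.
by rewrite -!expgM; congr (_ * y ^+ _); ring.
Qed.

(** * Metacyclic factorizations of p-groups of odd order *)

Section Factorization.

Context {gT : finGroupType} {p : nat} {P K : {group gT}}.
Hypotheses (p_pr : prime p) (p_odd : odd p) (pP : p.-group P).

Lemma card_factorization {S : {group gT}} :
  metacyclic_factorization P S K -> (#|S| = #|P : K| * #|S :&: K|)%N.
Proof.
case/and4P=> /and3P[_ nKP _] _ sSP /eqP defP.
apply/eqP; rewrite -(eqn_pmul2r (cardG_gt0 K)) mul_cardG.
have -> : S * K = P by rewrite -norm_joinEl ?(subset_trans sSP) ?normal_norm.
by rewrite -(Lagrange (normal_sub nKP)) -mulnA mulnC.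
Qed.

Lemma split_factorizationE {S : {group gT}} :
  metacyclic_factorization P S K ->
  split_factorization P S K = (#|S| == #|P : K|).
Proof.
move=> fS; rewrite /split_factorization fS (card_factorization fS) /=.
by rewrite -{2}[#|P : K|]muln1 eqn_pmul2l // -trivg_card1.
Qed.

(** By [expMg_p_power], a power of p that kills S and K kills every s * y. *)
Lemma exponent_factorization {S : {group gT}} :
  metacyclic_factorization P S K -> exponent P = maxn #|S| #|K|.
Proof.
case/and4P=> /and3P[cK nKP _] cS sSP /eqP defP.
have sKP := normal_sub nKP.
have [[a oS] [b oK]] := (p_natP (pgroupS sSP pP), p_natP (pgroupS sKP pP)).
have cyclic_le (C : {group gT}) : C \subset P -> cyclic C ->
    (#|C| <= exponent P)%N.
  move=> sCP /cyclicP[x defC]; rewrite defC dvdn_leq ?exponent_gt0 //.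
  by apply: dvdn_exponent; rewrite (subsetP sCP) // defC cycle_id.
apply/eqP; rewrite eqn_leq geq_max !cyclic_le // andbT.
have -> : maxn #|S| #|K| = (p ^ maxn a b)%N.
  rewrite oS oK; case: (leqP a b) => [leab | /ltnW leba].
    by rewrite (maxn_idPr _) // leq_exp2l ?prime_gt1.
  by rewrite (maxn_idPl _) // leq_exp2l ?prime_gt1.
rewrite dvdn_leq ?expn_gt0 ?prime_gt0 //; apply/exponentP => g.
have nKS : S \subset 'N(K) := subset_trans sSP (normal_norm nKP).
rewrite -defP norm_joinEl // => /mulsgP[x y Sx Ky ->].
have pKg := pgroupS sKP pP.
have px : p.-elt x := mem_p_elt pP (subsetP sSP x Sx).
have nKx := subsetP nKS x Sx.
have [w _ ->] // := expMg_p_power (maxn a b) p_pr p_odd pKg cK px nKx.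
have expg_max (C : {group gT}) c z : #|C| = (p ^ c)%N -> (c <= maxn a b)%N ->
    z \in C -> z ^+ (p ^ maxn a b) = 1.
  move=> oC lec Cz; apply/eqP; rewrite -order_dvdn.
  by apply: dvdn_trans (order_dvdG Cz) _; rewrite oC dvdn_exp2l.
rewrite expgM (expg_max S a) ?(expg_max K b) ?leq_maxl ?leq_maxr //.
by rewrite expg1n mulg1.
Qed.

Lemma factorization_exists :
  metacyclic_structure P K ->
  exists x, metacyclic_factorization P <[x]>%G K.
Proof.
move=> PK; have /and3P[_ nKP /cyclicP[xb defPK]] := PK.
have /morphimP[x Nx Px xbE] : xb \in P / K by rewrite defPK cycle_id.
exists x; rewrite /metacyclic_factorization PK cycle_cyclic cycle_subG Px /=.
have nKx : <[x]> \subset 'N(K) by rewrite cycle_subG.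
apply/eqP; rewrite joingC -quotientYK // quotient_cycle // -xbE -defPK.
by rewrite quotientGK.
Qed.

Lemma factorizationM {x y} :
  metacyclic_factorization P <[x]>%G K -> y \in K ->
  metacyclic_factorization P <[x * y]>%G K.
Proof.
case/and4P=> PK _; rewrite cycle_subG => Px /eqP defP Ky.
have /and3P[_ /normal_sub/subsetP sKP _] := PK.
rewrite /metacyclic_factorization PK cycle_cyclic cycle_subG.
rewrite (groupM Px) ?sKP //=.
rewrite -{1}defP eqEsubset !join_subG !joing_subr !cycle_subG !andbT.
have Jx (z : gT) : z \in <[z]> <*> K.
  by rewrite (subsetP (joing_subl _ _)) ?cycle_id.
have JK (z : gT) : y \in <[z]> <*> K.
  by rewrite (subsetP (joing_subr _ _)).
by rewrite groupM //= -(groupMr _ (JK (x * y))) Jx.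
Qed.

Lemma index_le_exponent :
  metacyclic_structure P K -> (#|P : K| <= exponent P)%N.
Proof.
case/factorization_exists=> x fx; rewrite (exponent_factorization fx) leq_max.
by rewrite (card_factorization fx) leq_pmulr.
Qed.

(** If x generates P modulo K then x ^+ q = k ^+ t for q = |P : K| and some
generator k of K.  Since x ^+ |K| = 1, the order |K| of k divides t |K| / q, so
q divides t and x ^+ q is the q-th power of some z in K.  The element y of K
with y ^+ w = z^-1 then makes x * y of order q. *)
Lemma splittable_card_exponent :
  metacyclic_structure P K -> #|K| = exponent P -> splittable P K.
Proof.
move=> PK oKe; have leqK := index_le_exponent PK; rewrite -oKe in leqK.
have [cK nKP _] := and3P PK; have sKP := normal_sub nKP.
have pK : p.-group K := pgroupS sKP pP.
have [x fx] := factorization_exists PK.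
have /and4P[_ _ + _] := fx; rewrite cycle_subG => Px.
have nKx : x \in 'N(K) := subsetP (normal_norm nKP) x Px.
have [b oq] : exists b, #|P : K| = (p ^ b)%N.
  have [b oPK] := p_natP (quotient_pgroup K pP).
  by exists b; rewrite -oPK card_quotient ?normal_norm.
have [a oK] := p_natP pK.
have leba : (b <= a)%N by rewrite oq oK leq_exp2l ?prime_gt1 in leqK.
have Kxq : x ^+ (p ^ b) \in K.
  rewrite coset_idr ?groupX // morphX //= -oq -card_quotient ?normal_norm //.
  by rewrite expg_cardG // mem_quotient.
have [z Kz xqE] : exists2 z, z \in K & x ^+ (p ^ b) = z ^+ (p ^ b).
  have /cyclicP[k defK] := cK.
  move: (Kxq); rewrite {1}defK => /cycleP[t xqt].
  have : k ^+ (t * p ^ (a - b)) == 1.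
    by rewrite expgM -xqt -expgM -expnD subnKC // -oK oKe expg_exponent.
  rewrite -order_dvdn orderE -defK oK -{1}(subnKC leba) expnD.
  rewrite dvdn_pmul2r ?expn_gt0 ?prime_gt0 // => /dvdnP[t' tE].
  by exists (k ^+ t'); rewrite ?defK ?mem_cycle // xqt tE expgM.
have px := mem_p_elt pP Px.
have [w co_w pow] := expMg_p_power b p_pr p_odd pK cK px nKx.
have co_Kw : coprime #|K| w by rewrite oK coprimeXl.
pose y := z^-1 ^+ expg_invn K w.
have Ky : y \in K by rewrite groupX ?groupV.
have yw : y ^+ w = z^-1 by rewrite /y expgAC expgK ?groupV.
have fxy := factorizationM fx Ky.
exists <[x * y]>%G; rewrite (split_factorizationE fxy) eqn_leq.
have -> : (#|P : K| <= #|<[x * y]>|)%N.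
  by rewrite (card_factorization fxy) leq_pmulr.
rewrite andbT oq dvdn_leq ?expn_gt0 ?prime_gt0 // -orderE order_dvdn pow //.
by rewrite mulnC expgM yw xqE expgVn mulgV.
Qed.

Lemma split_index_exponent {S : {group gT}} :
  #|P : K| = exponent P -> metacyclic_factorization P S K ->
  split_factorization P S K.
Proof.
move=> qe fS; rewrite (split_factorizationE fS) eqn_leq.
rewrite {1}qe (exponent_factorization fS) leq_maxl.
by rewrite (card_factorization fS) leq_pmulr.
Qed.

Lemma splittableE :
  metacyclic_structure P K ->
  splittable P K <-> #|P : K| = exponent P \/ #|K| = exponent P.
Proof.
move=> PK; split=> [[S] sS | [qe|]]; last exact: splittable_card_exponent.
  have /andP[fS _] := sS; move: sS; rewrite split_factorizationE // => /eqP <-.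
  by rewrite (exponent_factorization fS); case: leqP => _; [right | left].
have [x fx] := factorization_exists PK.
by exists <[x]>%G; apply: split_index_exponent.
Qed.

(** For the direct implication, compare the factorizations defined by x and by
x * k, where k generates K. *)
Lemma automatically_splitE :
  metacyclic_structure P K ->
  automatically_split P K <-> #|P : K| = exponent P.
Proof.
move=> PK; split=> [autoK | qe S]; last exact: split_index_exponent.
have [cK nKP _] := and3P PK; have pK := pgroupS (normal_sub nKP) pP.
have [x fx] := factorization_exists PK.
have /and4P[_ _ + _] := fx; rewrite cycle_subG => Px.
have nKx : x \in 'N(K) := subsetP (normal_norm nKP) x Px.
have px := mem_p_elt pP Px.
have order_gen z : metacyclic_factorization P <[z]>%G K -> #[z] = #|P : K|.
  by move=> fz; apply/eqP; rewrite -split_factorizationE ?autoK.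
have /cyclicP[k defK] := cK; have Kk : k \in K by rewrite defK cycle_id.
have [b ox] := p_natP px.
have [w co_w pow] := expMg_p_power b p_pr p_odd pK cK px nKx.
have : (x * k) ^+ (p ^ b) == 1.
  rewrite -ox (order_gen _ fx) -(order_gen _ (factorizationM fx Kk)).
  by rewrite expg_order.
have co_kw : coprime #[k] w.
  by have [a ->] := p_natP (mem_p_elt pK Kk); rewrite coprimeXl.
rewrite pow // -ox expg_order mul1g -order_dvdn Gauss_dvdl // => dvd_k.
rewrite -(order_gen _ fx) (exponent_factorization fx) (maxn_idPl _) //.
by rewrite defK dvdn_leq.
Qed.

End Factorization.

Theorem theorem1p2 (gT : finGroupType) (p : nat) (P K : {group gT})
    (p_prime : prime p) (p_odd : odd p)
    (pP : p.-group P) (metaP : metacyclic P) (nabP : ~~ abelian P)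
    (PK : metacyclic_structure P K) :
  [/\ non_splittable P K <->
        (#|K| < exponent P)%N /\ (#|P : K| < exponent P)%N,
      splittable P K /\ ~ automatically_split P K <->
        #|K| = exponent P /\ (#|P : K| < exponent P)%N
    & automatically_split P K <-> #|P : K| = exponent P].
Proof.
have splitE := splittableE p_prime p_odd pP PK.
have autoE := automatically_splitE p_prime p_odd pP PK.
have leqe := index_le_exponent p_prime p_odd pP PK.
have leKe : (#|K| <= exponent P)%N.
  have [x fx] := factorization_exists PK.
  by rewrite (exponent_factorization p_prime p_odd pP fx) leq_maxr.
have nonE : non_splittable P K <-> ~ splittable P K.
  split=> [nsK [S sS] | nsK S fS].
    by have /andP[fS _] := sS; move/negP: (nsK S fS).
  by apply/negP => sS; apply: nsK; exists S.
have lt_neq (m n : nat) : (m <= n)%N -> (m < n)%N <-> ~ m = n.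
  by rewrite ltn_neqAle => ->; rewrite andbT; split=> /eqP.
have ltq := lt_neq _ _ leqe; have ltK := lt_neq _ _ leKe; by split; tauto.
Qed.
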